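(* Let $n\ge1$ be the number of playing surfaces and suppose the current game between players $i$ and $j$ is played on surface $m\in\{1,\dots,n\}$. Let $\hat p_{ij}=p_{ij}(\boldsymbol\mu)$, $\hat p_{ji}=1-\hat p_{ij}$, and $C=\bigl(1+b^2\hat p_{ij}\hat p_{ji}(\sigma_m^2+\tau_m^2)\bigr)^{-1}$. Let the mean skills be updated by $\boldsymbol\mu'=\boldsymbol\mu-H^{-1}(\boldsymbol\mu)J(\boldsymbol\mu)$, where $J$ and $H$ are the gradient and Hessian of the log-posterior $\ell$ (see context). Then for every surface $l\in\{1,\dots,n\}$ the update of the mean skill of player $i$ on surface $l$ is $$\mu'_{il}=\mu_{il}+k_{il}\,(s_{ij}-\hat p_{ij}),\qquad\text{where } k_{il}=bC\sigma_m\sigma_l\rho_{ml}.$$ In particular, if $l=m$, then $\rho_{mm}=1$ and $k_{im}=bC\sigma_m^2$.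
   Context: Setting. There are $n$ types of playing surfaces. Players $i$ and $j$ have strength vectors $\boldsymbol\theta_i=(\theta_{i1},\dots,\theta_{in})^T$ and $\boldsymbol\theta_j=(\theta_{j1},\dots,\theta_{jn})^T$ with independent normal priors $N(\boldsymbol\mu_i,\Lambda_i)$ and $N(\boldsymbol\mu_j,\Lambda_j)$, where $\boldsymbol\mu_i=(\mu_{i1},\dots,\mu_{in})^T$, $\boldsymbol\mu_j=(\mu_{j1},\dots,\mu_{jn})^T$, and $\Lambda_i=(\sigma_{kl})_{k,l=1}^n$, $\Lambda_j=(\tau_{kl})_{k,l=1}^n$ are symmetric positive definite covariance matrices. Write $\sigma_{kk}=\sigma_k^2$ and $\tau_{kk}=\tau_k^2$ with $\sigma_k,\tau_k>0$. The correlation coefficient between surfaces $k$ and $l$ is denoted $\rho_{kl}$ and is the same for both players: $\sigma_{kl}=\rho_{kl}\sigma_k\sigma_l$ and $\tau_{kl}=\rho_{kl}\tau_k\tau_l$. Put $\boldsymbol\theta=(\boldsymbol\theta_i^T,\boldsymbol\theta_j^T)^T\in\mathbb R^{2n}$, $\boldsymbol\mu=(\boldsymbol\mu_i^T,\boldsymbol\mu_j^T)^T$, so $\boldsymbol\theta\sim N(\boldsymbol\mu,\Sigma)$ with $\Sigma=\mathrm{diag}(\Lambda_i,\Lambda_j)$. The updated mean is written $\boldsymbol\mu'=(\boldsymbol\mu_i'^T,\boldsymbol\mu_j'^T)^T$ with $\boldsymbol\mu'_i=(\mu'_{i1},\dots,\mu'_{in})^T$. Let $b=\log(10)/400$. If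 the game is played on surface $m$, the win probability of $i$ against $j$ is $p_{ij}(\boldsymbol\theta)=e^{b\theta_{im}}/(e^{b\theta_{im}}+e^{b\theta_{jm}})$. The outcome is $s_{ij}\in\{0,1\}$, with $s_{ij}=1$ if $i$ wins and $s_{ij}=0$ if $i$ loses. The log-posterior (up to an additive constant) is $$\ell(\boldsymbol\theta)=-\tfrac12(\boldsymbol\theta-\boldsymbol\mu)^T\Sigma^{-1}(\boldsymbol\theta-\boldsymbol\mu)+s_{ij}\log p_{ij}(\boldsymbol\theta)+(1-s_{ij})\log(1-p_{ij}(\boldsymbol\theta)).$$ $J(\boldsymbol\theta)=\nabla\ell(\boldsymbol\theta)\in\mathbb R^{2n}$ is its gradient and $H(\boldsymbol\theta)=\nabla^2\ell(\boldsymbol\theta)$ its $2n\times2n$ Hessian. *)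

(* Defs.v *)
From HB Require Import structures.
From mathcomp Require Import all_boot all_order all_algebra.
From mathcomp Require Import all_classical all_reals all_analysis.

Set Implicit Arguments.
Unset Strict Implicit.
Unset Printing Implicit Defensive.

Import Order.TTheory GRing.Theory Num.Theory.
Import numFieldNormedType.Exports.

Local Open Scope ring_scope.

Definition posdefmx (R : realType) (n : nat) (A : 'M[R]_n) : Prop :=
  A \is symmetricmx /\
  forall v : 'cV[R]_n, v != 0 -> 0 < (v^T *m A *m v) 0 0.

(* [derive] is total, so [partial], [gradient] and [hessian] are only
   meaningful where the relevant directional derivatives exist. *)
Definition partial (R : realType) (N : nat) (k : 'I_N)
    (f : 'cV[R]_N -> R) (x : 'cV[R]_N) : R :=
  'D_(delta_mx k 0) f x.

Definition gradient (R : realType) (N : nat)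
    (f : 'cV[R]_N -> R) (x : 'cV[R]_N) : 'cV[R]_N :=
  \col_k partial k f x.

Definition hessian (R : realType) (N : nat)
    (f : 'cV[R]_N -> R) (x : 'cV[R]_N) : 'M[R]_N :=
  \matrix_(k, l) partial k (partial l f) x.

Definition newton_update (R : realType) (N : nat)
    (f : 'cV[R]_N -> R) (x : 'cV[R]_N) : 'cV[R]_N :=
  x - invmx (hessian f x) *m gradient f x.

Definition elo_b (R : realType) : R := ln 10 / 400.

(* A vector of size [n + n] stacks the strengths of player i (indices
   [lshift n _]) on top of those of player j (indices [rshift n _]);
   this is the probability that i beats j on surface [m]. *)
Definition win_prob (R : realType) (n : nat) (m : 'I_n)
    (theta : 'cV[R]_(n + n)) : R :=
  let wi := expR (elo_b R * theta (lshift n m) 0) in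
  let wj := expR (elo_b R * theta (rshift n m) 0) in
  wi / (wi + wj).

(* Up to an additive constant; [s] is true iff player i wins, and [s%:R] is
   the outcome in {0, 1}. *)
Definition log_posterior (R : realType) (n : nat) (m : 'I_n)
    (mu : 'cV[R]_(n + n)) (Sigma : 'M[R]_(n + n)) (s : bool)
    (theta : 'cV[R]_(n + n)) : R :=
  - 2^-1 * ((theta - mu)^T *m invmx Sigma *m (theta - mu)) 0 0
  + s%:R * ln (win_prob m theta) + (1 - s%:R) * ln (1 - win_prob m theta).

(* Main.v *)
(* With w = e_m - e_(n+m) in R^(2n), the win probability is the logistic
   function of b w^T theta, so the Hessian of the log-posterior is the rank-one
   perturbation - (Sigma^-1 + c w w^T) of - Sigma^-1 with c = b^2 p_ij p_ji,
   and at the prior mean the gradient is b (s - p_ij) w.  Since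
   (Sigma^-1 + c w w^T) Sigma w = (1 + c w^T Sigma w) w, the Newton step is
   b (s - p_ij) / (1 + c w^T Sigma w) times Sigma w, and
   w^T Sigma w = sigma_m^2 + tau_m^2. *)

Require Import Defs.
From HB Require Import structures.
From mathcomp Require Import all_boot all_order all_algebra.
From mathcomp Require Import all_classical all_reals all_analysis.
From mathcomp Require Import ring.
Import Order.TTheory GRing.Theory Num.Theory.
Import numFieldNormedType.Exports.
Local Open Scope ring_scope.

(** * Partial derivatives and positive definite matrices *)

Lemma partial_is_derive (R : realType) (N : nat) (k : 'I_N)
    (f : 'cV[R]_N -> R) (x : 'cV[R]_N) (df : R) :
  is_derive (0 : R) 1 (fun t : R => f (t *: delta_mx k 0 + x)) df ->
  partial k f x = df.
Proof.
(* Both derivatives are limits of the same difference quotient, so partial derivatives reduce to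
   one-variable calculus at 0. *)
case=> _ <-; rewrite /partial /derive; do 2 f_equal.
by apply/funext => h /=; rewrite addr0 scale0r add0r [_ *: 1]mulr1.
Qed.

(** A nonzero row [v] with [v *m A = 0] would make the quadratic form vanish at [v^T]. *)
Lemma posdefmx_unit {R : realType} {n : nat} {A : 'M[R]_n} :
  posdefmx A -> A \in unitmx.
Proof.
move=> [_ A_gt0]; rewrite -row_free_unit; apply: inj_row_free => v vA0.
apply/eqP/negPn/negP => v_neq0.
have := A_gt0 v^T; rewrite -(inj_eq trmx_inj) trmxK trmx0 => /(_ v_neq0).
by rewrite vA0 mul0mx mxE ltxx.
Qed.

Lemma posdefmx_tr {R : realType} {n : nat} {A : 'M[R]_n} :
  posdefmx A -> A^T = A.
Proof.
by case=> + _; rewrite is_hermitianmxE expr0 scale1r map_mx_id // => /eqP <-.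
Qed.

(** * The logistic function and the log-likelihood of one game *)

Definition logistic (R : realType) (u : R) : R := (1 + expR (- u))^-1.

Lemma one_plus_expR_gt0 (R : realType) (u : R) : 0 < 1 + expR u.
Proof. by rewrite addr_gt0 ?expR_gt0. Qed.

Lemma one_sub_logistic (R : realType) (u : R) :
  1 - logistic R u = expR (- u) * logistic R u.
Proof.
have := lt0r_neq0 (one_plus_expR_gt0 R (- u)).
by rewrite /logistic => ?; field.
Qed.

Lemma logistic_gt0 (R : realType) (u : R) : 0 < logistic R u.
Proof. by rewrite invr_gt0 one_plus_expR_gt0. Qed.

Lemma is_derive_one_plus_expRN (R : realType) (u : R) :
  is_derive u 1 (fun v : R => 1 + expR (- v)) (- expR (- u)).
Proof.
have e' : is_derive u 1 (expR \o -%R) (expR (- u) * -1).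
  exact: is_derive1_comp.
have : is_derive u 1 (cst (1 : R) + (expR \o -%R)) (0 + expR (- u) * -1).
  exact: is_deriveD.
by rewrite add0r mulrN1.
Qed.

Lemma is_derive_logistic (R : realType) (u : R) :
  is_derive u 1 (logistic R) (logistic R u * (1 - logistic R u)).
Proof.
have h := lt0r_neq0 (one_plus_expR_gt0 R (- u)).
rewrite (_ : _ * _ = - (1 + expR (- u)) ^- 2 *: - expR (- u)).
  exact: (@is_deriveV R (fun v : R => 1 + expR (- v)) _ _ _ h
    (is_derive_one_plus_expRN R u)).
by rewrite one_sub_logistic /logistic /GRing.scale /=; field.
Qed.

(** As [1 - logistic u] is [expR (- u)] times [logistic u], the two logarithms differ by the linear
    term [u], and a single logarithm is left to differentiate. *)
Lemma bernoulli_log_logistic (R : realType) (s u : R) :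
  s * ln (logistic R u) + (1 - s) * ln (1 - logistic R u) =
  (s - 1) * u - ln (1 + expR (- u)).
Proof.
rewrite one_sub_logistic lnM ?posrE ?expR_gt0 ?logistic_gt0 // expRK.
by rewrite /logistic lnV ?posrE ?one_plus_expR_gt0 //; ring.
Qed.

Lemma is_derive_bernoulli_log_logistic (R : realType) (s u : R) :
  is_derive u 1
    (fun v : R => s * ln (logistic R v) + (1 - s) * ln (1 - logistic R v))
    (s - logistic R u).
Proof.
have h := one_plus_expR_gt0 R (- u).
rewrite (_ : (fun _ => _) =
    (s - 1) *: id - (@ln R \o (fun v : R => 1 + expR (- v)))); last first.
  by apply/funext => v; exact: bernoulli_log_logistic.
have dln : is_derive u 1 (@ln R \o (fun v : R => 1 + expR (- v)))
    ((1 + expR (- u))^-1 * - expR (- u)).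
  apply: is_derive1_comp; first exact: is_derive1_ln.
  exact: is_derive_one_plus_expRN.
apply: is_derive_eq; rewrite /logistic /GRing.scale /=; field.
exact: lt0r_neq0.
Qed.

(** Divide numerator and denominator by [wi]: the game sees [theta] only through the strength gap on
    surface [m]. *)
Lemma win_prob_logistic (R : realType) (n : nat) (m : 'I_n)
    (theta : 'cV[R]_(n + n)) :
  win_prob m theta =
  logistic R (elo_b R * (theta (lshift n m) 0 - theta (rshift n m) 0)).
Proof.
rewrite /win_prob /logistic mulrBr opprB expRD expRN.
have := expR_gt0 (elo_b R * theta (lshift n m) 0).
have := expR_gt0 (elo_b R * theta (rshift n m) 0).
set wj := expR _; set wi := expR _ => wj0 wi0.
by field; rewrite !gt_eqF ?addr_gt0.
Qed.

(** * Gradient and Hessian of the log-posterior along coordinate lines *)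

(* The vector w of the proof idea above: [w^T theta = theta_im - theta_jm]. *)
Definition gap (R : realType) (n : nat) (m : 'I_n) : 'cV[R]_(n + n) :=
  delta_mx (lshift n m) 0 - delta_mx (rshift n m) 0.

Lemma is_derive_affine (R : realType) (a c t : R) :
  is_derive t 1 (fun t : R => t * a + c) a.
Proof.
have -> : (fun t : R => t * a + c) = a *: id + cst c.
  by apply/funext => v /=; rewrite mulrC.
by apply: is_derive_eq; rewrite addr0 [LHS]mulr1.
Qed.

(** Symmetry of [P] merges the two cross terms. Factoring out [t] prepares the product rule at
    [t = 0]. *)
Lemma quadratic_form_line (R : realType) (N : nat) (k : 'I_N) (P : 'M[R]_N)
    (y : 'cV[R]_N) (t : R) : P^T = P ->
  ((t *: delta_mx k 0 + y)^T *m P *m (t *: delta_mx k 0 + y)) 0 0 =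
  t * (t * P k k + 2 * (P *m y) k 0) + (y^T *m P *m y) 0 0.
Proof.
move=> PT.
pose e : 'cV[R]_N := delta_mx k 0; rewrite -/e.
have eE (z : 'cV[R]_N) : (e^T *m z) 0 0 = z k 0.
  by rewrite trmx_delta -rowE mxE.
have yPe : (y^T *m (P *m e)) 0 0 = (P *m y) k 0.
  by rewrite mulmxA -[P in LHS]PT -trmx_mul -[e in LHS]trmxK -trmx_mul mxE eE.
have -> : (t *: e + y)^T = t *: e^T + y^T by rewrite linearD linearZ.
rewrite -mulmxA mulmxDr !mulmxDl -!scalemxAr -!scalemxAl.
rewrite !mulmxDr -!scalemxAr.
have addE (A B : 'M[R]_1) : (A + B) 0 0 = A 0 0 + B 0 0 by rewrite mxE.
have scaleE a (A : 'M[R]_1) : (a *: A) 0 0 = a * A 0 0 by rewrite mxE.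
rewrite !(addE, scaleE) yPe !eE mulmxA.
have -> : (P *m e) k 0 = P k k by rewrite -colE mxE.
ring.
Qed.

Lemma gap_line (R : realType) (n : nat) (m : 'I_n) (k : 'I_(n + n))
    (x : 'cV[R]_(n + n)) (t : R) :
  (t *: delta_mx k 0 + x) (lshift n m) 0 -
    (t *: delta_mx k 0 + x) (rshift n m) 0 =
  t * gap R n m k 0 + (x (lshift n m) 0 - x (rshift n m) 0).
Proof. by rewrite !mxE !andbT ![k == _]eq_sym; ring. Qed.

Lemma partial_log_posterior (R : realType) (n : nat) (m : 'I_n)
    (mu : 'cV[R]_(n + n)) (Sigma : 'M[R]_(n + n)) (s : bool)
    (k : 'I_(n + n)) (x : 'cV[R]_(n + n)) : Sigma^T = Sigma ->
  partial k (log_posterior m mu Sigma s) x =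
  - (invmx Sigma *m (x - mu)) k 0 +
  elo_b R * gap R n m k 0 * (s%:R - win_prob m x).
Proof.
move=> SigmaT; apply: partial_is_derive.
have PT : (invmx Sigma)^T = invmx Sigma by rewrite trmx_inv SigmaT.
rewrite win_prob_logistic; set P := invmx Sigma in PT *.
set b := elo_b R; set c := x (lshift n m) 0 - x (rshift n m) 0; set y := x - mu.
pose a := b * gap R n m k 0.
pose L v := s%:R * ln (logistic R v) + (1 - s%:R) * ln (1 - logistic R v).
pose A (t : R) := t * a + b * c.
(* [t * Q t] is the non-constant part of the Gaussian term, with the factor -1/2 absorbed; its
   derivative at 0 is just [Q 0]. *)
pose Q (t : R) := t * (- (P k k / 2)) + - (P *m y) k 0.
rewrite (_ : (fun _ => _) = id * Q + cst (- 2^-1 * (y^T *m P *m y) 0 0)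
    + (L \o A)); last first.
  apply/funext => t; rewrite !fctE /cst /=.
  have -> : A t = b * (t * gap R n m k 0 + c) by rewrite /A /a; ring.
  rewrite /log_posterior -/P -[_ + x - mu]addrA -/y quadratic_form_line //.
  by rewrite win_prob_logistic gap_line -/b -/c /L /Q; field.
have dQ : is_derive (0 : R) 1 Q (- (P k k / 2)) by exact: is_derive_affine.
have dL := is_derive_bernoulli_log_logistic R s%:R (A 0).
have dA : is_derive (0 : R) 1 A a by exact: is_derive_affine.
have dLA : is_derive (0 : R) 1 (L \o A) ((s%:R - logistic R (A 0)) * a).
  exact: is_derive1_comp.
have dIQ : is_derive (0 : R) 1 (id * Q)
  ((0 : R) *: - (P k k / 2) + Q 0 *: 1) by exact: is_deriveM.
have dfE : (0 : R) *: - (P k k / 2) + Q 0 *: 1 + 0 +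
    (s%:R - logistic R (A 0)) * a =
    - (P *m y) k 0 + b * gap R n m k 0 * (s%:R - logistic R (b * c)).
  by rewrite /A mul0r add0r /Q /GRing.scale /= /a; ring.
rewrite -dfE; exact: is_deriveD.
Qed.

Lemma hessian_log_posterior (R : realType) (n : nat) (m : 'I_n)
    (mu : 'cV[R]_(n + n)) (Sigma : 'M[R]_(n + n)) (s : bool)
    (x : 'cV[R]_(n + n)) : Sigma^T = Sigma ->
  hessian (log_posterior m mu Sigma s) x =
  - (invmx Sigma + (elo_b R ^+ 2 * win_prob m x * (1 - win_prob m x)) *:
       (gap R n m *m (gap R n m)^T)).
Proof.
move=> SigmaT; apply/matrixP => k l; rewrite mxE.
(* The gradient formula holds at every point, so it may replace the inner partial derivative as a
   function before the second differentiation. *)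
rewrite (_ : partial l _ = (fun x => - (invmx Sigma *m (x - mu)) l 0 +
  elo_b R * gap R n m l 0 * (s%:R - win_prob m x))); last first.
  by apply/funext => z; exact: partial_log_posterior.
apply: partial_is_derive; set b := elo_b R; set P := invmx Sigma.
set c := x (lshift n m) 0 - x (rshift n m) 0.
pose a := b * gap R n m k 0.
pose A (t : R) := t * a + b * c.
pose B (t : R) :=
  t * - P l k + (- (P *m (x - mu)) l 0 + b * gap R n m l 0 * s%:R).
rewrite (_ : (fun _ => _) = B + (- (b * gap R n m l 0)) *: (logistic R \o A));
    last first.
  apply/funext => t; rewrite !fctE /=.
  have -> : A t = b * (t * gap R n m k 0 + c) by rewrite /A /a; ring.
  rewrite win_prob_logistic gap_line -/b -/c /B -addrA mulmxDr -scalemxAr -colE.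
  by set z := P *m (x - mu); rewrite !mxE /GRing.scale /=; ring.
have dB : is_derive (0 : R) 1 B (- P l k) by exact: is_derive_affine.
have dL := is_derive_logistic R (A 0).
have dA : is_derive (0 : R) 1 A a by exact: is_derive_affine.
have dLA : is_derive (0 : R) 1 (logistic R \o A)
    (logistic R (A 0) * (1 - logistic R (A 0)) * a).
  exact: is_derive1_comp.
have pE : win_prob m x = logistic R (A 0).
  by rewrite /A mul0r add0r win_prob_logistic.
have PT : P^T = P by rewrite trmx_inv SigmaT.
have dfE : - P l k + - (b * gap R n m l 0) *:
      (logistic R (A 0) * (1 - logistic R (A 0)) * a) =
    (- (P + (b ^+ 2 * win_prob m x * (1 - win_prob m x)) *:
       (gap R n m *m (gap R n m)^T))) k l.
  (* The inner derivative is along [l], which yields the transposed entry. *)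
  have -> : P l k = P k l by rewrite -{1}PT mxE.
  have wwE : (gap R n m *m (gap R n m)^T) k l = gap R n m k 0 * gap R n m l 0.
    by rewrite mxE big_ord1 [_^T _ _]mxE.
  rewrite pE; set p := logistic R (A 0).
  transitivity (- (P k l + b ^+ 2 * p * (1 - p) *
      (gap R n m *m (gap R n m)^T) k l)).
    by rewrite wwE /a /GRing.scale /=; ring.
  set W := gap R n m *m _.
  by rewrite !mxE.
rewrite -dfE; exact: is_deriveD.
Qed.

(** * Inverting a rank-one perturbation *)

Lemma rank1_update_mul (R : realType) (N : nat) (S : 'M[R]_N) (w : 'cV[R]_N)
    (c : R) : S \in unitmx ->
  (invmx S + c *: (w *m w^T)) *m (S *m w) =
  (1 + c * (w^T *m S *m w) 0 0) *: w.
Proof.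
move=> S_unit; set q := w^T *m S *m w.
have wq : w *m q = q 0 0 *: w by rewrite {1}[q]mx11_scalar mul_mx_scalar.
rewrite mulmxDl mulKmx // -scalemxAl scalerDl scale1r -scalerA -wq.
by rewrite !mulmxA.
Qed.

(** The inverse exhibited is the Sherman-Morrison formula. *)
Lemma rank1_update_unit (R : realType) (N : nat) (S : 'M[R]_N) (w : 'cV[R]_N)
    (c : R) : S \in unitmx -> 1 + c * (w^T *m S *m w) 0 0 != 0 ->
  invmx S + c *: (w *m w^T) \in unitmx.
Proof.
move=> S_unit d_neq0.
pose k := c / (1 + c * (w^T *m S *m w) 0 0).
suff /mulmx1_unit[//] : (invmx S + c *: (w *m w^T)) *m
    (S - k *: (S *m w *m (w^T *m S))) = 1%:M.
rewrite mulmxBr -scalemxAr [_ *m (S *m w *m _)]mulmxA rank1_update_mul //.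
rewrite -scalemxAl scalerA.
rewrite divfK // mulmxDl mulVmx // -scalemxAl mulmxA.
by rewrite -addrA subrr addr0.
Qed.

(** The claimed step is multiplied back by the matrix and then cancelled; invertibility is essential
    because [invmx] returns its argument on singular matrices. *)
Lemma rank1_update_newton_step (R : realType) (N : nat) (S : 'M[R]_N)
    (w : 'cV[R]_N) (a c : R) : S \in unitmx ->
  1 + c * (w^T *m S *m w) 0 0 != 0 ->
  invmx (- (invmx S + c *: (w *m w^T))) *m (a *: w) =
  - ((a / (1 + c * (w^T *m S *m w) 0 0)) *: (S *m w)).
Proof.
move=> S_unit d_neq0; have H_unit := rank1_update_unit _ _ _ _ _ S_unit d_neq0.
have <- : (- (invmx S + c *: (w *m w^T))) *m
    - ((a / (1 + c * (w^T *m S *m w) 0 0)) *: (S *m w)) = a *: w.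
  by rewrite mulNmx mulmxN opprK -scalemxAr rank1_update_mul // scalerA divfK.
by rewrite mulKmx // -scaleN1r unitmxZ // unitrN1.
Qed.

(** * The gap vector against the block-diagonal covariance *)

Lemma mul_gap (R : realType) (n : nat) (m : 'I_n) (S : 'M[R]_(n + n))
    (k : 'I_(n + n)) :
  (S *m gap R n m) k 0 = S k (lshift n m) - S k (rshift n m).
Proof. by rewrite mulmxBr -!colE !mxE. Qed.

Lemma gap_quadratic_form (R : realType) (n : nat) (m : 'I_n)
    (A B : 'M[R]_n) :
  ((gap R n m)^T *m block_mx A 0 0 B *m gap R n m) 0 0 = A m m + B m m.
Proof.
have gapT_mul (z : 'cV[R]_(n + n)) :
    ((gap R n m)^T *m z) 0 0 = z (lshift n m) 0 - z (rshift n m) 0.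
  by rewrite linearB /= !trmx_delta mulmxBl -!rowE !mxE.
rewrite -mulmxA gapT_mul !mul_gap.
by rewrite block_mxEul block_mxEur block_mxEdl block_mxEdr !mxE; ring.
Qed.

Theorem theorem1 (R : realType) (n : nat) (n_ge1 : (1 <= n)%N) (m : 'I_n)
  (mu_i mu_j : 'cV[R]_n) (Lambda_i Lambda_j : 'M[R]_n)
  (sigma tau : 'I_n -> R) (rho : 'I_n -> 'I_n -> R) (s : bool)
  (Lambda_i_posdef : posdefmx Lambda_i)
  (Lambda_j_posdef : posdefmx Lambda_j)
  (sigma_gt0 : forall k, 0 < sigma k)
  (tau_gt0 : forall k, 0 < tau k)
  (Lambda_i_diag : forall k, Lambda_i k k = sigma k ^+ 2)
  (Lambda_j_diag : forall k, Lambda_j k k = tau k ^+ 2)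
  (Lambda_i_corr : forall k l, Lambda_i k l = rho k l * sigma k * sigma l)
  (Lambda_j_corr : forall k l, Lambda_j k l = rho k l * tau k * tau l) :
  let mu : 'cV[R]_(n + n) := col_mx mu_i mu_j in
  let Sigma : 'M[R]_(n + n) := block_mx Lambda_i 0 0 Lambda_j in
  let ell := log_posterior m mu Sigma s in
  let b := elo_b R in
  let p_ij := win_prob m mu in
  let p_ji := 1 - p_ij in
  let C := (1 + b ^+ 2 * p_ij * p_ji * (sigma m ^+ 2 + tau m ^+ 2))^-1 in
  let k_i := fun l => b * C * sigma m * sigma l * rho m l in
  let mu' := newton_update ell mu in
  let mu_i' := usubmx mu' in
  [/\ hessian ell mu \in unitmx,
      forall l, mu_i' l 0 = mu_i l 0 + k_i l * (s%:R - p_ij),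
      rho m m = 1
    & k_i m = b * C * sigma m ^+ 2].
Proof.
move=> mu Sigma ell b p p' C k_i mu' mu_i'.
have Sigma_unit : Sigma \in unitmx.
  by rewrite block_diag_mx_unit !posdefmx_unit.
have SigmaT : Sigma^T = Sigma by rewrite tr_block_mx !trmx0 !posdefmx_tr.
pose w := gap R n m.
have p_gt0 : 0 < p by rewrite /p win_prob_logistic logistic_gt0.
have p'_gt0 : 0 < p'.
  rewrite /p' /p win_prob_logistic one_sub_logistic.
  by rewrite mulr_gt0 ?expR_gt0 ?logistic_gt0.
have wSwE : (w^T *m Sigma *m w) 0 0 = sigma m ^+ 2 + tau m ^+ 2.
  by rewrite gap_quadratic_form Lambda_i_diag Lambda_j_diag.
have d_neq0 : 1 + b ^+ 2 * p * p' * (w^T *m Sigma *m w) 0 0 != 0.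
  (* The denominator is 1 plus a product of nonnegative factors. *)
  rewrite wSwE gt_eqF // ltr_pwDl // mulr_ge0 ?addr_ge0 ?sqr_ge0 //.
  by rewrite mulr_ge0 ?(ltW p'_gt0) // mulr_ge0 ?(ltW p_gt0) // sqr_ge0.
have HE : hessian ell mu = - (invmx Sigma + (b ^+ 2 * p * p') *: (w *m w^T)).
  exact: hessian_log_posterior.
have JE : gradient ell mu = (b * (s%:R - p)) *: w.
  (* At the prior mean the Gaussian term is stationary, so only the game contributes. *)
  apply/colP => k; rewrite mxE partial_log_posterior // subrr mulmx0 !mxE.
  by rewrite oppr0 add0r mulrAC.
have rho_mm : rho m m = 1.
  (* Comparing the two expressions for the variance gives [(1 - rho m m) * sigma m ^+ 2 = 0]. *)
  have := Lambda_i_corr m m; rewrite Lambda_i_diag -mulrA -expr2 => /eqP.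
  rewrite -subr_eq0 -{1}[_ ^+ 2]mul1r -mulrBl mulf_eq0 sqrf_eq0.
  by rewrite (gt_eqF (sigma_gt0 m)) orbF subr_eq0 => /eqP <-.
split=> //.
- rewrite HE -scaleN1r unitmxZ ?unitrN1 //.
  exact: rank1_update_unit.
- move=> l; rewrite /mu_i' /mu' /newton_update HE JE.
  rewrite rank1_update_newton_step // opprK wSwE -/C.
  rewrite [LHS]mxE [LHS]mxE col_mxEu; congr (_ + _).
  (* Rows of player i meet the zero block in the columns of player j, so [tau] enters only through
     [C]. *)
  have -> a : (a *: (Sigma *m w)) (lshift n l) 0 = a * Lambda_i l m.
    by rewrite mxE mul_gap block_mxEul block_mxEur [X in _ - X]mxE subr0.
  (* The entry found is [(l, m)], whereas [k_i] uses [rho m l]; the swap comes from symmetry of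
     [Lambda_i], as none is assumed of [rho]. *)
  rewrite -(posdefmx_tr Lambda_i_posdef) mxE Lambda_i_corr /k_i /C.
  by ring.
- by rewrite /k_i rho_mm; ring.
Qed.
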